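(* For $1\le k\le m$ let $M_{m,k}$ and $K_{m,k}$ be the smallest numbers with the property $$\|\widehat{D}^k\widehat{L}\|\le M_{m,k}\|\widehat{L}\|\qquad\text{and}\qquad\|D^k\widehat{L}\|\le K_{m,k}\|\widehat{L}\|,$$ respectively, for every continuous $m$-homogeneous polynomial $\widehat{L}$ on any real Banach space $X$. Then $$\frac{m^m\,k!}{(m-k)^{(m-k)}k^k}\le M_{m,k}\le\binom{m}{k}\frac{k!\,m^{m/2}}{(m-k)^{(m-k)/2}k^{k/2}}$$ and $$\frac{m^m}{(m-k)^{(m-k)}}\le K_{m,k}\le\binom{m}{k}\frac{m^{m/2}k^{k/2}}{(m-k)^{(m-k)/2}}.$$
   Context: A continuous $m$-homogeneous polynomial $\widehat{L}:X\to\mathbb{R}$ on a real Banach space $X$ is a map of the form $\widehat{L}(x)=L(x,\ldots,x)$ with $L:X^m\to\mathbb{R}$ continuous, symmetric and $m$-linear. $B_X$ is the closed unit ball of $X$ and $\|\widehat{L}\|=\sup_{x\in B_X}|\widehat{L}(x)|$. $D^k\widehat{L}(x)$ is the $k$th Fréchet derivative of $\widehat{L}$ at $x$, a symmetric $k$-linear form on $X$, and $\widehat{D}^k\widehat{L}(x)$ is the associated $k$-homogeneous polynomial $y\mapsto D^k\widehat{L}(x)(y,\ldots,y)$. The norms are $\|\widehat{D}^k\widehat{L}\|=\sup_{x,y\in B_X}|\widehat{D}^k\widehat{L}(x)y|$ and $\|D^k\widehat{L}\|=\sup_{x,y_1,\ldots,y_k\in B_X}|D^k\widehat{L}(x)(y_1,\ldots,y_k)|$.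 Convention: $0^0=1$. *)

(* Defs.v *)
From HB Require Import structures.
From mathcomp Require Export all_boot all_order all_fingroup all_algebra.
From mathcomp Require Export all_classical all_reals all_analysis.

#[export] Set Implicit Arguments.
#[export] Unset Strict Implicit.
#[export] Unset Printing Implicit Defensive.

Export Order.TTheory GRing.Theory Num.Theory numFieldNormedType.Exports.

Local Open Scope classical_set_scope.
Local Open Scope ring_scope.

(* The m-th power of X is the function type 'I_m -> X; [dfwith v u] is v with
   its i-th entry replaced by u. *)
Definition multilinear_form (R : realType) (X : normedModType R) (m : nat)
    (L : ('I_m -> X) -> R) : Prop :=
  forall (i : 'I_m) (v : 'I_m -> X),
    scalar (fun u : X => L (@dfwith _ (fun=> X) v i u)).

Definition symmetric_form (R : realType) (X : normedModType R) (m : nat)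
    (L : ('I_m -> X) -> R) : Prop :=
  forall (s : 'S_m) (v : 'I_m -> X), L (v \o s) = L v.

(* Continuity for the product topology on the m-th power of X. *)
Definition continuous_form (R : realType) (X : normedModType R) (m : nat)
    (L : ('I_m -> X) -> R) : Prop :=
  continuous (L : {ptws 'I_m -> X} -> R).

Definition homogeneous_polynomial (R : realType) (X : normedModType R)
    (m : nat) (P : X -> R) : Prop :=
  exists L : ('I_m -> X) -> R,
    [/\ continuous_form L, symmetric_form L, multilinear_form L &
        forall x, P x = L (fun=> x)].

Definition unit_ball (R : realType) (X : normedModType R) : set X :=
  closed_ball (0 : X) 1.
Arguments unit_ball {R X}.

Definition vcons (X : Type) (k : nat) (h : X) (y : 'I_k -> X) : 'I_k.+1 -> X :=
  fun i => if unlift ord0 i is Some j then y j else h.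

(* Let F be a map from X to the space of continuous k-linear forms, normed by
   the supremum over the k-th power of the unit ball.  A continuous linear map
   from X to that space is the same thing as a continuous (k+1)-linear form A,
   via h |-> A(h, .); A is the Frechet derivative of F at x when
   F(x + h) - F(x) - A(h, .) = o(h) in that norm. *)
Definition is_frechet (R : realType) (X : normedModType R) (k : nat)
    (F : X -> ('I_k -> X) -> R) (x : X) (A : ('I_k.+1 -> X) -> R) : Prop :=
  [/\ continuous_form A, multilinear_form A &
      forall e : R, 0 < e -> \forall h \near (0 : X),
        forall y : 'I_k -> X, (forall i, unit_ball (y i)) ->
          `|F (x + h) y - F x y - A (vcons h y)| <= e * `|h| ].

(* The k-th Frechet derivative as a total function: the derivative of the
   (k-1)-st one, which is unique when it exists (junk value otherwise, as for
   ['d f x] in the library). *)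
Fixpoint frechetD (R : realType) (X : normedModType R) (k : nat) (f : X -> R) :
    X -> ('I_k -> X) -> R :=
  match k return X -> ('I_k -> X) -> R with
  | 0 => fun x _ => f x
  | j.+1 => fun x => xget (fun=> 0) (is_frechet (@frechetD R X j f) x)
  end.

Definition frechetD_poly (R : realType) (X : normedModType R) (k : nat)
    (f : X -> R) (x y : X) : R := frechetD (k := k) f x (fun=> y).

Definition poly_norm (R : realType) (X : normedModType R) (P : X -> R) :
    \bar R :=
  ereal_sup [set (`|P x|)%:E | x in unit_ball].

Definition frechetD_poly_norm (R : realType) (X : normedModType R) (k : nat)
    (f : X -> R) : \bar R :=
  ereal_sup [set z | exists x y : X,
    [/\ unit_ball x, unit_ball y & z = (`|frechetD_poly k f x y|)%:E]].

Definition frechetD_norm (R : realType) (X : normedModType R) (k : nat)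
    (f : X -> R) : \bar R :=
  ereal_sup [set z | exists (x : X) (y : 'I_k -> X),
    [/\ unit_ball x, (forall i, unit_ball (y i)) &
        z = (`|frechetD f x y|)%:E]].

Definition poly_markov_constants (R : realType) (m k : nat) : set R :=
  [set M : R | forall (X : completeNormedModType R) (P : X -> R),
    homogeneous_polynomial m P ->
    (frechetD_poly_norm k P <= M%:E * poly_norm P)%E].

Definition form_markov_constants (R : realType) (m k : nat) : set R :=
  [set K : R | forall (X : completeNormedModType R) (P : X -> R),
    homogeneous_polynomial m P ->
    (frechetD_norm k P <= K%:E * poly_norm P)%E].

Arguments poly_markov_constants : clear implicits.
Arguments form_markov_constants : clear implicits.

Definition is_smallest (R : realType) (S : set R) (a : R) : Prop :=
  S a /\ lbound S a.

(* Main.v *)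
From HB Require Import structures.
Require Import Defs.
From mathcomp Require Import zify ring lra.

(** Let L be the symmetric m-linear form of the polynomial P.  The k-th
    derivative of P at x is the form that sends y_1, ..., y_k to
    m! / (m - k)! * L(x, ..., x, y_1, ..., y_k), with x repeated m - k times
    ([frechetD_formS]).  Both estimates therefore compare mixed values of L
    with the values of P on the unit ball.

    Upper bounds.  For unit vectors x and y, put a^2 = (m - k)/m and
    b^2 = k/m.  Since a^2 + b^2 = 1, the ellipse of the points
    cos t * a x + sin t * b y lies in the unit ball, so that P is at most ||P||
    on it.  Restricted to the plane parametrized by this ellipse, P is a
    polynomial on a Euclidean plane, where the polarization constant is 1 by a
    theorem of Banach ([banach_angle_bound]).  Hence
    a^(m-k) b^k |L(x, ..., x, y, ..., y)| <= ||P||, which is the bound for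
    the derivative polynomial ([mixed_bound]).  The bound for the derivative
    form follows by the classical polarization inequality, which costs the
    factor k^k / k! ([polarization_bound]).

    Banach's theorem is proved by compactness.  Among the tuples of angles at
    which |L| is maximal, choose one for which the sum of the squares is
    minimal.  As a function of two of the angles, a and b, the form is
    D cos (a - b) + E (a + b) ([angle_form_pair]).  If a and b differ, then
    maximality forces D = 0 or |a - b| = pi, and in both cases there is a
    maximal tuple with a smaller sum of squares.  So all angles are equal, and
    the maximum is a value of P.

    Lower bounds.  On the space of m-tuples with the sum norm, the product of
    the coordinates has norm at most m^(-m) by the inequality of the means,
    and its symmetric form is the normalized permanent.  The permanent is
    evaluated at x = (0, ..., 0, 1/(m-k), ..., 1/(m-k)), together with
    y = (1/k, ..., 1/k, 0, ..., 0) for the derivative polynomial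
    ([deriv_poly_ge]), and with the first k unit vectors for the derivative
    form ([deriv_form_ge]).

    The smallest constants exist because the admissible constants form a
    nonempty set that is bounded below and contains its infimum
    ([smallest_exists]). *)

Local Open Scope classical_set_scope.
Local Open Scope ring_scope.

(** * Bounded multilinear forms *)

Section Pointwise.
Context (I : choiceType) (Y : uniformType).

(** Convergence in the product topology is convergence of every coordinate. *)
Lemma cvg_ptws (F : set_system (I -> Y)) (f : I -> Y) : Filter F ->
  (forall i, (g i @[g --> F] --> f i)) -> F --> (f : {ptws I -> Y}).
Proof.
by move=> FF Fi; apply/(@pointwise_cvgP (discrete_topology I) _ F f).
Qed.

Lemma continuous_ptws (T : topologicalType) (f : T -> I -> Y) :
  (forall i, continuous (f ^~ i)) -> continuous (f : T -> {ptws I -> Y}).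
Proof. by move=> fc t; apply: cvg_ptws => i; apply: fc. Qed.

Lemma ptws_eval_continuous (i : I) :
  continuous (fun f : {ptws I -> Y} => f i).
Proof. exact: (@proj_continuous I (fun=> Y) i). Qed.

End Pointwise.

Lemma updE (I : eqType) (T : Type) (v : I -> T) i u j :
  @dfwith I (fun=> T) v i u j = if j == i then u else v j.
Proof. by rewrite eq_sym; case: dfwithP => [|j' /negbTE->]; rewrite ?eqxx. Qed.

Section Multilinear.
Context (R : realType) (X : normedModType R) (m : nat) (L : ('I_m -> X) -> R).
Local Notation upd v i u := (@dfwith _ (fun=> X) v i u).
Hypothesis Lmul : multilinear_form L.

Lemma form_at0 i v : L (upd v i 0) = 0.
Proof.
have := Lmul i v 1 0 0; rewrite scaler0 addr0 mul1r => /eqP.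
by rewrite -subr_eq subrr => /eqP.
Qed.

Lemma form_atZ i v a u :
  L (upd v i (a *: u)) = a * L (upd v i u).
Proof. by have := Lmul i v a u 0; rewrite /= !addr0 form_at0 addr0. Qed.

Lemma form_scale (a : 'I_m -> R) v :
  L (fun i => a i *: v i) = (\prod_i a i) * L v.
Proof.
pose w (r : seq 'I_m) i := if i \in r then a i *: v i else v i.
have wE r : uniq r -> L (w r) = (\prod_(i <- r) a i) * L v.
  elim: r => [|j r IHr] /=; first by rewrite big_nil mul1r.
  case/andP=> jr /IHr; rewrite big_cons -mulrA => <-.
  have -> : w (j :: r) = upd (w r) j (a j *: v j).
    by apply/funext => i; rewrite updE /w inE; case: eqP => [->|].
  rewrite form_atZ; congr (_ * L _); apply/funext => i.
  by rewrite updE /w; case: eqP => // ->; rewrite (negbTE jr).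
rewrite -wE ?index_enum_uniq//; congr (L _); apply/funext => i.
by rewrite /w mem_index_enum.
Qed.

Lemma form_eq0 v i : v i = 0 -> L v = 0.
Proof.
move=> vi0; rewrite -(form_at0 i v) -vi0; congr (L _); apply/funext => j.
by rewrite updE; case: eqP => // ->.
Qed.

(** Continuity at 0 is tested against the filter of the sets of tuples whose
    entries all have norm less than e: it converges to 0 coordinatewise, hence
    in the product topology.  So L is bounded by 1 on such tuples for some e,
    and homogeneity in each variable gives the bound. *)
Lemma form_bounded : continuous_form L -> (0 < m)%N ->
  exists2 C, 0 <= C & forall v, `|L v| <= C * \prod_i `|v i|.
Proof.
move=> Lc m0; have i0 := Ordinal m0.
pose F := filter_from [set e : R | 0 < e]
  (fun e => [set v : 'I_m -> X | forall i, `|v i| < e]).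
have FF : Filter F.
  apply: filter_from_filter; first by exists 1; rewrite /= ltr01.
  move=> e d /= e0 d0; exists (Num.min e d); first by rewrite /= lt_min e0 d0.
  by move=> v /= vb; split=> i; have := vb i; rewrite lt_min => /andP[].
have F0 : F --> ((fun=> 0) : {ptws 'I_m -> X}).
  apply: cvg_ptws => i; apply/cvgrPdist_lt => e e0; exists e => // v /= /(_ i).
  by rewrite sub0r normrN.
have /cvgrPdist_lt/(_ 1 ltr01)[d /= d0 dL] : L v @[v --> F] --> L (fun=> 0).
  exact: cvg_trans (cvg_app L F0) (Lc _).
exists ((2 / d) ^+ m); first by rewrite exprn_ge0// divr_ge0// ltW.
move=> v; have [/existsP[i /eqP vi0]|] := boolP [exists i, v i == 0].
  by rewrite (form_eq0 vi0) normr0 mulr_ge0 ?prodr_ge0// exprn_ge0// divr_ge0// ltW.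
rewrite negb_exists => /forallP vn0.
have v0 i : 0 < `|v i| by rewrite normr_gt0.
pose a i := 2 / d * `|v i|.
have a0 i : 0 < a i by rewrite mulr_gt0// divr_gt0.
have -> : v = (fun i => a i *: ((a i)^-1 *: v i)).
  by apply/funext => i; rewrite scalerA divff ?scale1r// gt_eqF.
rewrite form_scale normrM.
have -> : \prod_i `|a i *: ((a i)^-1 *: v i)| = \prod_i `|v i|.
  by apply: eq_bigr => i _; rewrite scalerA divff ?scale1r// gt_eqF.
have -> : (2 / d) ^+ m * \prod_i `|v i| = `|\prod_i a i|.
  rewrite ger0_norm; last by apply: prodr_ge0 => i _; apply: ltW.
  by rewrite /a big_split /= prodr_const card_ord.
rewrite ler_piMr//; have := dL (fun i => (a i)^-1 *: v i).
rewrite (@form_eq0 (fun=> 0) i0)// sub0r normrN => dLv; apply/ltW/dLv => i.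
rewrite normrZ ger0_norm ?invr_ge0 ?ltW// /a invfM invf_div -mulrA mulVf ?gt_eqF//.
by rewrite mulr1 ltr_pdivrMr// ltr_pMr// ltr1n.
Qed.

End Multilinear.

(** * Polarization of symmetric forms *)

Ltac perm_count := apply/seq.permP => ?;
  rewrite /= ?(count_cat, count_nseq) /= ?(count_cat, count_nseq) /=; lia.

Section SymmetricForm.
Context (R : realType) (X : normedModType R) (m : nat) (L : ('I_m -> X) -> R).
Local Notation upd v i u := (@dfwith _ (fun=> X) v i u).
Hypothesis Lmul : multilinear_form L.
Hypothesis Lsym : symmetric_form L.

(** On sequences of length m, symmetry of L becomes invariance under
    [perm_eq], and linearity in the head gives linearity in every entry.  The
    default value 0 of [nth] is only met by shorter sequences. *)
Definition formS (s : seq X) : R := L (fun i => nth 0 s i).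

Lemma formS_perm s t : size s = m -> perm_eq s t -> formS s = formS t.
Proof.
move=> sm; rewrite perm_sym => st.
have tm : size t == m by rewrite (perm_size st) sm.
have sm' : size s == m by rewrite sm.
have /tuple_permP[p tE] : perm_eq (Tuple tm) (Tuple sm') by [].
rewrite /formS -(Lsym p); congr (L _); apply/funext => i /=.
have -> : t = [tuple tnth (Tuple sm') (p i) | i < m] by [].
by rewrite -tnth_nth tnth_map tnth_ord_tuple (tnth_nth 0).
Qed.

(** With a fixed tail, the form is L with one free entry, so that the
    multilinearity of L applies to the head. *)
Lemma formS_at s : (size s).+1 = m -> exists i0 : 'I_m,
  forall u, formS (u :: s) =
    L (upd (fun i : 'I_m => nth 0 (0 :: s) i) i0 u).
Proof.
move=> sm; have m0 : (0 < m)%N by rewrite -sm.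
exists (Ordinal m0) => v; congr (L _); apply/funext => i.
by rewrite updE -val_eqE; case: i => -[].
Qed.

Lemma formSD u v s : (size s).+1 = m ->
  formS (u + v :: s) = formS (u :: s) + formS (v :: s).
Proof.
move=> /formS_at[i E]; rewrite !E -{1}(scale1r u).
by have := Lmul i (fun i => nth 0 (0 :: s) i) 1 u v; rewrite mul1r.
Qed.

Lemma formSZ a u s : (size s).+1 = m -> formS (a *: u :: s) = a * formS (u :: s).
Proof. by move=> /formS_at[i E]; rewrite !E form_atZ. Qed.

Lemma formS_nseqZ a n s z : (size s + n)%N = m ->
  formS (s ++ nseq n (a *: z)) = a ^+ n * formS (s ++ nseq n z).
Proof.
elim: n s => [|n IHn] s sm; first by rewrite expr0 mul1r.
have sm' : (size (s ++ nseq n (a *: z))).+1 = m.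
  by rewrite size_cat size_nseq -sm addnS.
rewrite (@formS_perm _ (a *: z :: s ++ nseq n (a *: z))).
- rewrite formSZ// -cat_cons IHn ?exprS ?mulrA; last by rewrite /= addSnnS.
  congr (_ * _); apply: formS_perm; first by rewrite size_cat size_nseq /= addSnnS.
  by perm_count.
- by rewrite size_cat size_nseq.
- by perm_count.
Qed.

Lemma formS_binomial n s x h : (size s + n)%N = m ->
  formS (s ++ nseq n (x + h)) =
  \sum_(j < n.+1) 'C(n, j)%:R * formS (s ++ nseq j h ++ nseq (n - j) x).
Proof.
elim: n s => [|n IHn] s sm; first by rewrite big_ord1 mul1r.
pose G j := formS (s ++ nseq j h ++ nseq (n.+1 - j) x).
rewrite -[RHS]/(\sum_(j < n.+2) 'C(n.+1, j)%:R * G j).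
rewrite (@formS_perm _ ((x + h) :: s ++ nseq n (x + h))); first last.
- by perm_count.
- by rewrite size_cat size_nseq.
rewrite formSD; last by rewrite size_cat size_nseq -addnS.
rewrite -!cat_cons !IHn; try by rewrite /= addSnnS.
have -> : \sum_(j < n.+1) 'C(n, j)%:R * formS ((x :: s) ++ nseq j h ++ nseq (n - j) x)
    = \sum_(j < n.+1) 'C(n, j)%:R * G j.
  apply: eq_bigr => j _; congr (_ * _).
  have jn : (j <= n)%N by rewrite -ltnS.
  apply: formS_perm; first by rewrite /= !size_cat !size_nseq subnKC// -addnS.
  by rewrite subSn//; perm_count.
have -> : \sum_(j < n.+1) 'C(n, j)%:R * formS ((h :: s) ++ nseq j h ++ nseq (n - j) x)
    = \sum_(j < n.+1) 'C(n, j)%:R * G j.+1.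
  apply: eq_bigr => j _; congr (_ * _).
  have jn : (j <= n)%N by rewrite -ltnS.
  apply: formS_perm; first by rewrite /= !size_cat !size_nseq subnKC// -addnS.
  by rewrite subSS; perm_count.
have -> : \sum_(j < n.+1) 'C(n, j)%:R * G j = \sum_(j < n.+2) 'C(n, j)%:R * G j.
  by rewrite [RHS]big_ord_recr /= bin_small// mul0r addr0.
rewrite 2![in RHS]big_ord_recl [in LHS]big_ord_recl /= !bin0 -!addrA; congr (_ + _).
rewrite (eq_bigr (fun j : 'I_n.+1 => 'C(n, j.+1)%:R * G j.+1))// -big_split /=.
rewrite -[RHS](big_ord_recl n (fun j => 'C(n.+1, j.+1)%:R * G j.+1)).
by apply: eq_bigr => j _; rewrite binS natrD mulrDl.
Qed.

(** Iterated central difference: the sum, over all choices of signs e_i, of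
    the product of the signs times g (w + sum_i e_i y_i). *)
Fixpoint pdiff (ys : seq X) (g : X -> R) (w : X) : R :=
  if ys is y :: ys' then pdiff ys' g (w + y) - pdiff ys' g (w - y) else g w.

Lemma pdiff_shift ys g a w :
  pdiff ys g (w + a) = pdiff ys (fun z => g (z + a)) w.
Proof.
elim: ys w => //= y ys IHys w.
by rewrite -(IHys (w + y)) -(IHys (w - y)) (addrAC w y) (addrAC w (- y)).
Qed.

Lemma pdiff_sum ys n (c : 'I_n -> R) (g : 'I_n -> X -> R) w :
  pdiff ys (fun z => \sum_(j < n) c j * g j z) w =
  \sum_(j < n) c j * pdiff ys (g j) w.
Proof.
elim: ys w => //= y ys IHys w; rewrite !IHys -sumrB.
by apply: eq_bigr => j _; rewrite mulrBr.
Qed.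

(** Taylor expansion about w - y in powers of 2 y: one central difference in
    direction y kills the leading term and so lowers the degree in w.  When the
    degree n equals the number r of differences, only the terms that are linear
    in each direction survive, with coefficient 2^r r!; when it is smaller, all
    terms vanish. *)
Lemma pdiff_formS ys s n w : (size s + n)%N = m -> (n <= size ys)%N ->
  pdiff ys (fun z => formS (s ++ nseq n z)) w =
  if n == size ys then 2 ^+ n * n`!%:R * formS (s ++ ys) else 0.
Proof.
elim: ys s n w => [|y ys IHys] s n w sm /=.
  by rewrite leqn0 => /eqP ->; rewrite eqxx expr0 !mul1r.
move=> nys; pose y2 := 2 *: y.
(* Expand about w - y, so that the term of degree 0 cancels. *)
have -> : w + y = (w - y) + y2 by rewrite /y2 scaler_nat mulr2n addrA subrK.
rewrite pdiff_shift.
have -> : (fun z => formS (s ++ nseq n (z + y2))) =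
  (fun z => \sum_(j < n.+1) 'C(n, j)%:R * formS (s ++ nseq j y2 ++ nseq (n - j) z)).
  by apply/funext => z; rewrite formS_binomial.
rewrite (@pdiff_sum _ _ (fun j : 'I_n.+1 => 'C(n, j)%:R)
  (fun j z => formS (s ++ nseq j y2 ++ nseq (n - j) z))).
rewrite big_ord_recl /= bin0 mul1r subn0 addrC addKr.
case: n => [|n] in sm nys *; first by rewrite big_ord0.
rewrite (eq_bigr (fun j : 'I_n.+1 => 'C(n.+1, j.+1)%:R * (if (n - j == size ys)%N
  then 2 ^+ n * n`!%:R * formS (s ++ y2 :: ys) else 0))); last first.
  move=> j _; congr (_ * _); rewrite /bump /= add1n subSS.
  have jn : (j <= n)%N by rewrite -ltnS.
  have -> : (fun z => formS (s ++ y2 :: nseq j y2 ++ nseq (n - j) z)) =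
    (fun z => formS ((s ++ nseq j.+1 y2) ++ nseq (n - j) z)).
    by apply/funext => z; rewrite -catA.
  rewrite IHys; last 2 first.
  - by rewrite size_cat size_nseq -sm; lia.
  - lia.
  case: eqP => // nj; have -> : (j = 0 :> nat)%N by lia.
  by rewrite subn0 -catA.
rewrite big_ord_recl /= bin1 subn0 big1 => [|j _]; last first.
  by rewrite ifN ?mulr0// /bump /=; apply/eqP; have := ltn_ord j; lia.
rewrite addr0 eqSS; case: eqP => [nE|]; last by rewrite mulr0.
rewrite (@formS_perm _ (y2 :: s ++ ys)); first last.
- by perm_count.
- by rewrite size_cat /=; lia.
rewrite /y2 formSZ; last by rewrite size_cat -nE -addnS.
rewrite (@formS_perm (s ++ y :: ys) (y :: s ++ ys)); first last.
- by perm_count.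
- by rewrite size_cat /=; lia.
by rewrite factS natrM exprS; ring.
Qed.

Lemma pdiff_bound ys (g : X -> R) w B :
  (forall z, `|z| <= `|w| + \sum_(y <- ys) `|y| -> `|g z| <= B) ->
  `|pdiff ys g w| <= 2 ^+ size ys * B.
Proof.
elim: ys w => [|y ys IHys] w /=.
  by move=> gB; rewrite mul1r; apply: gB; rewrite big_nil addr0.
rewrite big_cons => gB; apply: le_trans (ler_normB _ _) _.
rewrite exprS -mulrA mulrDl mul1r mulr2n.
by apply: lerD; apply: IHys => z zw; apply: gB; apply: le_trans zw _;
  rewrite addrA lerD2r ?ler_normD ?ler_normB.
Qed.

(** The polarization formula expresses 2^k k! times the mixed value as a
    signed sum of 2^k values of the k-homogeneous polynomial at vectors of norm
    at most k. *)
Lemma polarization_bound (c : R) k s ys : (size s + k)%N = m -> size ys = k ->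
  (forall y, y \in ys -> `|y| <= 1) ->
  (forall z, `|z| <= 1 -> `|formS (s ++ nseq k z)| <= c) ->
  k`!%:R * `|formS (s ++ ys)| <= k%:R ^+ k * c.
Proof.
move=> sm ysk ys1 zc.
have sum_ys : \sum_(y <- ys) `|y| <= k%:R.
  rewrite -ysk -sum1_size natr_sum; move: ys1; elim: ys {ysk} => [|y ys IHys] ys1.
    by rewrite !big_nil.
  rewrite !big_cons lerD ?ys1 ?mem_head// IHys// => z zs.
  by apply: ys1; rewrite inE zs orbT.
have bound z : `|z| <= k%:R -> `|formS (s ++ nseq k z)| <= k%:R ^+ k * c.
  have [k0 zk|k0 zk] := posnP k.
    by have := zc 0; rewrite normr0 ler01 k0 expr0 !mul1r; apply.
  have k0' : 0 < k%:R :> R by rewrite ltr0n.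
  have -> : z = k%:R *: (k%:R^-1 *: z) by rewrite scalerA divff ?scale1r// gt_eqF.
  rewrite formS_nseqZ// normrM normrX ger0_norm ?ler0n//.
  rewrite ler_wpM2l ?exprn_ge0 ?ler0n// zc// normrZ ger0_norm ?invr_ge0 ?ler0n//.
  by rewrite ler_pdivrMl// mulr1.
have := @pdiff_bound ys (fun z => formS (s ++ nseq k z)) 0 (k%:R ^+ k * c).
rewrite pdiff_formS ?ysk// eqxx normr0 add0r !normrM normrX.
rewrite (ger0_norm (ler0n R 2)) ger0_norm// -mulrA ler_pM2l ?exprn_gt0//; apply.
by move=> z zs; apply: bound; apply: le_trans sum_ys.
Qed.

End SymmetricForm.

(** * Derivatives of homogeneous polynomials *)

Section Frechet.
Context (R : realType) (X : normedModType R).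
Local Notation upd v i u := (@dfwith _ (fun=> X) v i u).

Lemma unit_ballE (x : X) : unit_ball x <-> `|x| <= 1.
Proof.
by rewrite /unit_ball closed_ballE// /closed_ball_ /= sub0r normrN.
Qed.

(** The first entry is a slot of the multilinear form. *)
Lemma vcons_upd k h (y : 'I_k -> X) : vcons h y = upd (vcons 0 y) ord0 h.
Proof.
apply/funext => i; rewrite updE /vcons; case: eqP => [->|/eqP i0].
  by rewrite unlift_none.
by case: unliftP i0 => [//|->]; rewrite eqxx.
Qed.

Lemma vcons_eta k (v : 'I_k.+1 -> X) : v = vcons (v ord0) (v \o lift ord0).
Proof. by apply/funext => i; rewrite /vcons; case: unliftP => [j|] ->. Qed.

Lemma codom_vcons k h (y : 'I_k -> X) : codom (vcons h y) = h :: codom y.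
Proof.
rewrite /codom /image_mem enum_ordSl /= -map_comp /vcons unlift_none.
by congr (_ :: _); apply: eq_map => i /=; rewrite liftK.
Qed.

(** Two candidates A and B differ by a multilinear form that is o(h) in its
    first entry h, uniformly for the other entries in the unit ball.  Replacing
    h by t h with t small shows that it vanishes there, and it vanishes
    everywhere since each entry can be scaled into the unit ball. *)
Lemma frechet_unique k (F : X -> ('I_k -> X) -> R) x A B :
  is_frechet F x A -> is_frechet F x B -> A = B.
Proof.
move=> [_ Am FA] [_ Bm FB].
have eqAB h y : (forall i, unit_ball (y i)) -> A (vcons h y) = B (vcons h y).
  move=> y1; apply/eqP; rewrite -subr_eq0 -normr_le0.
  apply/ler_addgt0Pl => e e0; rewrite addr0.
  pose d := e / (2 * (`|h| + 1)).
  have h1 : 0 < `|h| + 1 by rewrite ltr_wpDl.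
  have d0 : 0 < d by rewrite divr_gt0// mulr_gt0.
  have : \forall z \near (0 : X), `|A (vcons z y) - B (vcons z y)| <= 2 * d * `|z|.
    apply: filterS2 (FA d d0) (FB d d0) => z /(_ y y1) zA /(_ y y1) zB.
    rewrite -mulrA mulrDl mul1r.
    have -> : A (vcons z y) - B (vcons z y) =
      (F (x + z) y - F x y - B (vcons z y)) - (F (x + z) y - F x y - A (vcons z y)).
      by ring.
    by apply: le_trans (ler_normB _ _) (lerD zB zA).
  move=> /nbhs_ballP[r /= r0 rP]; pose t := r / (2 * (`|h| + 1)).
  have t0 : 0 < t by rewrite divr_gt0// mulr_gt0.
  have := rP (t *: h); rewrite -ball_normE /= sub0r normrN normrZ gtr0_norm//.
  rewrite !(vcons_upd (t *: h)) !form_atZ// -!vcons_upd -mulrBr normrM gtr0_norm//.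
  rewrite mulrCA ler_pM2l// => th; apply: (le_trans (th _)).
    by rewrite /t mulrAC ltr_pdivrMr ?mulr_gt0// ltr_pM2l//; have := normr_ge0 h; lra.
  have -> : 2 * d * `|h| = e * (`|h| / (`|h| + 1)) by rewrite /d; field; rewrite gt_eqF.
  by apply: ler_piMr; [exact: ltW|rewrite ler_pdivrMr// mul1r lerDl].
apply/funext => v; pose a i := `|v i| + 1.
have a0 i : 0 < a i by rewrite ltr_wpDl.
pose w i := (a i)^-1 *: v i.
have -> : v = (fun i => a i *: w i).
  by apply/funext => i; rewrite scalerA divff ?scale1r// gt_eqF.
rewrite (form_scale Am a w) (form_scale Bm a w); congr (_ * _).
rewrite (vcons_eta w); apply: eqAB => i; rewrite /= /w.
move: (lift _ _) => {}i; apply/unit_ballE; rewrite normrZ gtr0_norm ?invr_gt0//.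
by rewrite ler_pdivrMl// mulr1 lerDl.
Qed.

Context (m : nat) (L : ('I_m -> X) -> R).
Hypothesis Lcont : continuous_form L.
Hypothesis Lmul : multilinear_form L.
Hypothesis Lsym : symmetric_form L.
Local Notation LS := (formS L).

Lemma formS_bounded : (0 < m)%N ->
  exists2 C, 0 <= C & forall s, size s = m -> `|LS s| <= C * \prod_(z <- s) `|z|.
Proof.
move=> m0; have [C C0 CL] := form_bounded Lmul Lcont m0; exists C => // s sm.
apply: le_trans (CL _) _; rewrite (big_nth 0) big_mkord sm.
by rewrite lexx.
Qed.

(** The k-th derivative in closed form: the falling factorial counts the ways
    to put y_1, ..., y_k into k of the m slots of L. *)
Definition derivF k (x : X) (y : 'I_k -> X) : R :=
  (m ^_ k)%:R * LS (codom y ++ nseq (m - k) x).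

Lemma size_args k (y : 'I_k -> X) x : (k <= m)%N ->
  size (codom y ++ nseq (m - k) x) = m.
Proof. by move=> km; rewrite size_cat size_codom card_ord size_nseq subnKC. Qed.

Lemma derivF_continuous k x : continuous_form (derivF (k := k) x).
Proof.
pose args (y : {ptws 'I_k -> X}) : {ptws 'I_m -> X} :=
  fun i => nth 0 (codom y ++ nseq (m - k) x) i.
suff argsc : continuous args.
  by move=> y; exact: cvgM (cvg_cst _) (continuous_comp (argsc y) (@Lcont _)).
apply: continuous_ptws => i; rewrite /args.
have [ik|ki] := ltnP i k.
  have -> : (fun y : {ptws 'I_k -> X} => nth 0 (codom y ++ nseq (m - k) x) i) =
            (fun y => y (Ordinal ik)).
    apply/funext => z; rewrite nth_cat size_codom card_ord ik.
    rewrite (nth_map (Ordinal ik)) ?size_enum_ord//; congr (z _).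
    by apply: val_inj; rewrite /= nth_enum_ord.
  exact: ptws_eval_continuous.
have -> : (fun y : {ptws 'I_k -> X} => nth 0 (codom y ++ nseq (m - k) x) i) =
          (fun=> nth 0 (nseq (m - k) x) (i - k)).
  by apply/funext => z; rewrite nth_cat size_codom card_ord ltnNge ki.
exact: cst_continuous.
Qed.

(** The tuple with y_i replaced by u is, up to order, u followed by entries
    that do not depend on u. *)
Lemma derivF_multilinear k x : (k <= m)%N -> multilinear_form (derivF (k := k) x).
Proof.
move=> km i v a u w; rewrite /derivF.
pose r := [seq v j | j <- [seq j <- enum 'I_k | j != i]] ++ nseq (m - k) x.
have pe : perm_eq (enum 'I_k) (i :: [seq j <- enum 'I_k | j != i]).
  by rewrite -(rem_filter _ (enum_uniq _)) perm_to_rem// mem_enum.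
have rE u' : LS (codom (upd v i u') ++ nseq (m - k) x) = LS (u' :: r).
  apply: formS_perm => //; first exact: size_args.
  rewrite -cat_cons perm_cat2r /codom /image_mem.
  rewrite (perm_trans (perm_map _ pe))//= updE eqxx perm_cons.
  have -> // : [seq upd v i u' j | j <- enum 'I_k & j != i] =
      [seq v j | j <- enum 'I_k & j != i].
  by apply/eq_in_map => j; rewrite mem_filter updE => /andP[/negbTE->].
rewrite !rE.
have rm : (size r).+1 = m.
  have /= := perm_size pe; rewrite size_enum_ord => pk.
  by rewrite size_cat size_map -addSn -pk size_nseq subnKC.
rewrite formSD// formSZ//= mulrDr; congr (_ + _).
by rewrite mulrCA.
Qed.

(** In the binomial expansion in h of the form with entries x + h, the term of
    degree 0 is the value at x, the term of degree 1 is the claimed derivative,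
    and the others are O(|h|^2), uniformly for y_i in the unit ball. *)
Lemma derivF_frechet k x : (k < m)%N ->
  is_frechet (derivF (k := k)) x (derivF (k := k.+1) x).
Proof.
move=> km; split; [exact: derivF_continuous|exact: derivF_multilinear|].
have m0 : (0 < m)%N by case: m km.
have [C C0 CL] := formS_bounded m0.
pose n := (m - k.+1)%N; have nE : (m - k)%N = n.+1 by rewrite /n; lia.
pose rho := 1 + `|x|; have rho1 : 1 <= rho by rewrite lerDl.
pose D := (m ^_ k)%:R * \sum_(j < n) ('C(n.+1, j.+2)%:R * (C * rho ^+ m)).
have D0 : 0 <= D.
  rewrite mulr_ge0//; apply: sumr_ge0 => j _.
  by rewrite !mulr_ge0// exprn_ge0// (le_trans ler01).
suff DP h (y : 'I_k -> X) : `|h| <= 1 -> (forall i, unit_ball (y i)) ->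
    `|derivF (x + h) y - derivF x y - derivF x (vcons h y)| <= D * `|h| ^+ 2.
  move=> e e0; apply/nbhs_ballP; exists (Num.min 1 (e / (D + 1))).
    by rewrite /= lt_min ltr01 divr_gt0// ltr_wpDl.
  move=> h; rewrite -ball_normE /= sub0r normrN lt_min => /andP[/ltW h1 he] y y1.
  apply: le_trans (DP h y h1 y1) _; rewrite expr2 mulrA ler_wpM2r//.
  move: he; rewrite ltr_pdivlMr ?ltr_wpDl// mulrDr mulr1 mulrC => he.
  by apply: ltW; apply: le_lt_trans he; rewrite lerDl.
move=> h1 y1; rewrite /derivF codom_vcons nE formS_binomial//; last first.
  by rewrite size_codom card_ord; lia.
rewrite 2!big_ord_recl /bump /= bin0 bin1 mul1r ?(subn0, subSS).
rewrite ffactnSr nE natrM -/n.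
set S := \sum_(i < n) _.
rewrite (@formS_perm _ _ _ _ Lsym (h :: codom y ++ nseq n x)
  (codom y ++ h :: nseq n x)); first last.
- by perm_count.
- by rewrite /= size_cat size_codom card_ord size_nseq /n; lia.
have -> : forall c a b d : R, c * (a + (d * b + S)) - c * a - c * d * b = c * S.
  by move=> *; ring.
rewrite normrM ger0_norm// /D -mulrA ler_wpM2l// mulr_suml.
apply: le_trans (ler_norm_sum _ _ _) _; apply: ler_sum => j _.
have jn : (j < n)%N by [].
rewrite ?add1n subSS normrM ger0_norm// -mulrA ler_wpM2l//.
have sm : size (codom y ++ [:: h, h & nseq j h] ++ nseq (n - j.+1) x) = m.
  by rewrite /= !size_cat /= !size_cat !size_nseq size_codom card_ord;
    rewrite /n in jn *; lia.
apply: le_trans (CL _ sm) _; rewrite -mulrA ler_wpM2l//.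
rewrite big_cat /= !big_cons big_cat /=.
have -> : rho ^+ m * `|h| ^+ 2 = 1 * (`|h| * (`|h| * (1 * rho ^+ m))) by ring.
have prod_nseq (c : R) (z : X) N : `|z| <= c -> \prod_(i <- nseq N z) `|i| <= c ^+ N.
  move=> zc; elim: N => [|N IHN]; first by rewrite big_nil.
  by rewrite big_cons exprS ler_pM// prodr_ge0.
rewrite ler_pM ?mulr_ge0 ?prodr_ge0//.
  rewrite big_map; apply: prodr_ile1 => i.
  by move=> _; rewrite normr_ge0; apply/unit_ballE.
rewrite !ler_wpM2l// ler_pM ?prodr_ge0//.
  by rewrite (le_trans (prod_nseq 1 _ _ _))// expr1n.
apply: le_trans (prod_nseq rho _ _ _) _; first by rewrite lerDr.
by rewrite ler_weXn2l// /n; lia.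
Qed.

Lemma frechetD_formS k x y : (k <= m)%N ->
  frechetD (k := k) (fun x => L (fun=> x)) x y = derivF x y.
Proof.
elim: k x y => [|k IHk] x y km.
  rewrite /derivF ffactn0 mul1r subn0 /= /formS; congr (L _).
  apply/funext => i; rewrite /codom /image_mem.
  have -> : enum 'I_0 = [::] by apply: size0nil; rewrite size_enum_ord.
  by rewrite nth_nseq ltn_ord.
have E : frechetD (k := k) (fun x => L (fun=> x)) = derivF (k := k).
  by apply/funext => z; apply/funext => w; apply: IHk; apply: ltnW.
rewrite /= E; have dF := derivF_frechet x km.
by rewrite (frechet_unique (xgetPex (fun=> 0) (ex_intro _ _ dF)) dF).
Qed.

End Frechet.

(** * Banach's theorem on a Euclidean plane *)

Section Banach.
Context (R : realType) (X : normedModType R) (m : nat) (L : ('I_m -> X) -> R).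
Hypothesis Lcont : continuous_form L.
Hypothesis Lmul : multilinear_form L.
Hypothesis Lsym : symmetric_form L.
Local Notation updX v i u := (@dfwith _ (fun=> X) v i u).
Local Notation updR v i u := (@dfwith _ (fun=> R) v i u).
Context (x y : X).

Definition ellipse (t : R) : X := cos t *: x + sin t *: y.

Definition angle_form (th : 'I_m -> R) : R := L (fun i => ellipse (th i)).

Lemma form_at_ellipse i v t : L (updX v i (ellipse t)) =
  cos t * L (updX v i x) + sin t * L (updX v i y).
Proof.
by rewrite /ellipse -form_atZ//; have := Lmul i v (cos t) x (sin t *: y) => /= ->;
  rewrite !form_atZ.
Qed.

(** A symmetric bilinear form on the plane, evaluated at the points of angles
    a and b, is a trigonometric polynomial in a - b and a + b; symmetry removes
    the sine of a - b. *)
Lemma angle_form_pair th i j : i != j -> exists D A C : R, forall a b,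
  angle_form (updR (updR th i a) j b) =
  D * cos (a - b) + (A * cos (a + b) + C * sin (a + b)).
Proof.
move=> ij; pose w l := ellipse (th l).
pose B u v := L (updX (updX w i u) j v).
have wE a b : angle_form (updR (updR th i a) j b) = B (ellipse a) (ellipse b).
  rewrite /angle_form /B; congr (L _); apply/funext => l; rewrite !updE /w.
  by case: eqP => // _; case: eqP.
have Bswap u v : updX (updX w i u) j v = updX (updX w j v) i u.
  apply/funext => l; rewrite !updE; case: eqP => [->|//].
  by rewrite eq_sym (negbTE ij).
have Bsym u v : B u v = B v u.
  rewrite /B -(Lsym (tperm i j)); congr (L _); apply/funext => l /=.
  rewrite !updE; case: tpermP => [->|->|/eqP/negbTE -> /eqP/negbTE ->//].
  - by rewrite eqxx (negbTE ij) eqxx.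
  - by rewrite (negbTE ij) !eqxx.
have Bl a v : B (ellipse a) v = cos a * B x v + sin a * B y v.
  by rewrite /B !Bswap form_at_ellipse.
have Br b u : B u (ellipse b) = cos b * B u x + sin b * B u y.
  by rewrite /B form_at_ellipse.
exists ((B x x + B y y) / 2), ((B x x - B y y) / 2), (B x y) => a b.
rewrite wE Bl !Br (Bsym y x) cosB cosD sinD; by field.
Qed.

(** The two upper bounds give |D| + |E| <= |D c + E| <= |D| |c| + |E|,
    where |c| < 1. *)
Lemma dominated_cos (D E c : R) : c ^+ 2 < 1 ->
  `|D + E| <= `|D * c + E| -> `|D - E| <= `|D * c + E| -> D = 0.
Proof.
move=> c1; have sq (u v : R) : `|u| <= `|v| -> u ^+ 2 <= v ^+ 2.
  by rewrite -(real_normK (num_real u)) -(real_normK (num_real v)) ler_pXn2r.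
move=> /sq h1 /sq h2.
have [c_lt1 c_gtN1] : 1 - c > 0 /\ 1 + c > 0.
  have : `|c| < 1 by rewrite -(@ltr_pXn2r _ 2)// ?nnegrE// real_normK ?num_real// expr1n.
  by rewrite ltr_norml => /andP[? ?]; split; lra.
apply/eqP; rewrite -sqrf_eq0 eq_le sqr_ge0 andbT.
rewrite -(@pmulr_rle0 _ (2 * (1 - c ^+ 2))); last by rewrite mulr_gt0// subr_gt0.
have k1 : (1 + c) * ((D + E) ^+ 2 - (D * c + E) ^+ 2) <= 0.
  by rewrite pmulr_rle0// subr_le0.
have k2 : (1 - c) * ((D - E) ^+ 2 - (D * c + E) ^+ 2) <= 0.
  by rewrite pmulr_rle0// subr_le0.
apply: le_trans (_ : _ <= (1 + c) * ((D + E) ^+ 2 - (D * c + E) ^+ 2) +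
   (1 - c) * ((D - E) ^+ 2 - (D * c + E) ^+ 2)) _; last by lra.
by rewrite le_eqVlt; apply/orP; left; apply/eqP; ring.
Qed.

Lemma ellipse_continuous : continuous ellipse.
Proof.
move=> t; exact: cvgD (cvgZ (@continuous_cos R t) (cvg_cst x))
  (cvgZ (@continuous_sin R t) (cvg_cst y)).
Qed.

Lemma angle_form_continuous : continuous (angle_form : {ptws 'I_m -> R} -> R).
Proof.
pose f (th : {ptws 'I_m -> R}) : {ptws 'I_m -> X} := fun i => ellipse (th i).
have fc : continuous f.
  apply: continuous_ptws => i th.
  exact: continuous_comp (@ptws_eval_continuous 'I_m R i th) (@ellipse_continuous _).
by move=> th; exact: continuous_comp (fc th) (@Lcont _).
Qed.

(** Banach's theorem: the polarization constant of a Euclidean plane is 1.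
    Since the points of angles t and t + pi are opposite, the angles can be
    restricted to the compact interval [0, pi], on which both the maximum of
    the form and the minimum of the sum of squares are attained. *)
Lemma banach_angle_bound (c : R) : (0 < m)%N ->
  (forall t, `|L (fun=> ellipse t)| <= c) ->
  forall th, (forall i, 0 <= th i <= pi) -> `|angle_form th| <= c.
Proof.
move=> m0 Lc th thK; have i0 := Ordinal m0.
pose K : set {ptws 'I_m -> R} := [set f | forall i, `[0, pi]%classic (f i)].
have KP (f : 'I_m -> R) : K f <-> forall i, 0 <= f i <= pi.
  by split=> fK i; have := fK i; rewrite /= in_itv.
have Kcompact : compact K.
  by apply: (@tychonoff 'I_m (fun=> R) (fun=> `[0, pi]%classic)) => i;
    exact: segment_compact.
pose F : {ptws 'I_m -> R} -> R := fun f => `|angle_form f|.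
have Fc : continuous F.
  by move=> f; apply: (continuous_comp (@angle_form_continuous f)); exact: norm_continuous.
have [f0 f0K f0max] : exists2 f0, f0 \in K & forall f, f \in K -> F f <= F f0.
  apply: compact_EVT_max => //; first by exists th; apply/KP.
  exact: continuous_subspaceT.
rewrite inE in f0K.
pose K2 : set {ptws 'I_m -> R} := K `&` F @^-1` [set F f0].
have K2compact : compact K2.
  apply: compact_closedI => //.
  by apply: (@preimage_closed _ _ F [set F f0]) => [f _|]; [exact: Fc|exact: closed_eq].
pose S : {ptws 'I_m -> R} -> R := fun f => \sum_i f i ^+ 2.
have Sc : continuous S.
  apply: continuous_big => [|i _ f]; first exact: add_continuous.
  exact: continuous_comp (@ptws_eval_continuous 'I_m R i f) (@exprn_continuous R 2 _).
(* A maximal tuple with the smallest sum of squares. *)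
have [f1 f1K2 f1min] : exists2 f1, f1 \in K2 & forall f, f \in K2 -> S f1 <= S f.
  apply: compact_EVT_min => //; first by exists f0.
  exact: continuous_subspaceT.
move: f1K2; rewrite inE => -[f1K /= f1F].
have pi0 := @pi_gt0 R.
suff f1cst i j : f1 i <= f1 j.
  have -> : `|angle_form th| <= c = (F th <= c) by [].
  apply: le_trans (f0max th _) _; first by rewrite inE; apply/KP.
  rewrite -f1F; apply: le_trans (Lc (f1 i0)); rewrite /F /angle_form.
  have -> // : (fun i => ellipse (f1 i)) = (fun=> ellipse (f1 i0)).
  by apply/funext => i; congr ellipse; apply/eqP; rewrite eq_le !f1cst.
rewrite leNgt; apply/negP => ji.
have ij : i != j by apply: contraTneq ji => ->; rewrite ltxx.
have [D [A [C DE]]] := angle_form_pair f1 ij.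
pose B a b := angle_form (updR (updR f1 i a) j b).
set a1 := f1 i in ji; set b1 := f1 j in ji.
have B1 : `|B a1 b1| = F f0.
  rewrite -f1F /F /B; congr `|angle_form _|; apply/funext => l.
  by rewrite !updE; case: eqP => [->//|_]; case: eqP => // ->.
have inK a b : 0 <= a <= pi -> 0 <= b <= pi -> K (updR (updR f1 i a) j b).
  move=> aK bK; apply/KP => l; rewrite !updE; case: eqP => // _; case: eqP => // _.
  exact: ((KP f1).1 f1K).
have Bmax a b : 0 <= a <= pi -> 0 <= b <= pi -> `|B a b| <= `|B a1 b1|.
  by move=> aK bK; rewrite B1; apply: f0max; rewrite inE; apply: inK.
have Bmin a b : 0 <= a <= pi -> 0 <= b <= pi -> `|B a b| = `|B a1 b1| ->
    a1 ^+ 2 + b1 ^+ 2 <= a ^+ 2 + b ^+ 2.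
  move=> aK bK Bab; have : S f1 <= S (updR (updR f1 i a) j b).
    by apply: f1min; rewrite inE; split; [exact: inK|rewrite /= -B1].
  rewrite /S (bigD1 i)//= (bigD1 j) 1?eq_sym//=.
  rewrite [leRHS](bigD1 i)//= [in leRHS](bigD1 j) 1?eq_sym//=.
  rewrite !updE eqxx (negbTE ij) eqxx !addrA.
  rewrite [X in _ <= _ + X](eq_bigr (fun l => f1 l ^+ 2)) ?lerD2r//.
  by move=> l /andP[/negbTE li /negbTE lj]; rewrite !updE li lj.
have /andP[a0 api] : 0 <= a1 <= pi by apply: ((KP f1).1 f1K).
have /andP[b0 bpi] : 0 <= b1 <= pi by apply: ((KP f1).1 f1K).
have BE a b : B a b = D * cos (a - b) + (A * cos (a + b) + C * sin (a + b)).
  exact: DE.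
(* At the end points 0 and pi, the tuple with both angles 0 is maximal. *)
have [abpi|abpi] := eqVneq (a1 - b1) pi.
  have [a1E b1E] : a1 = pi /\ b1 = 0 by split; lra.
  have := Bmin 0 0; rewrite lexx ltW// => /(_ isT isT).
  rewrite !BE a1E b1E !subr0 !addr0 cos0 sin0 cospi sinpi.
  have -> : D * -1 + (A * -1 + C * 0) = - (D * 1 + (A * 1 + C * 0)) by ring.
  rewrite normrN => /(_ erefl); rewrite expr0n /= !addr0 leNgt => /negP; apply.
  by rewrite exprn_gt0.
(* The form takes the value D + E when both angles are the midpoint g, and the
   value D - E when both are g + pi / 2 or both are g - pi / 2. *)
pose g := (a1 + b1) / 2; pose E := A * cos (a1 + b1) + C * sin (a1 + b1).
have gK : 0 <= g <= pi by rewrite /g; lra.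
have Bg : B g g = D + E.
  by rewrite BE subrr cos0 mulr1 /E; have -> : g + g = a1 + b1 by rewrite /g; field.
have D0 : D = 0.
  apply: (@dominated_cos D E (cos (a1 - b1))).
  - have := cos2Dsin2 (a1 - b1).
    have : 0 < sin (a1 - b1).
      by apply: sin_gt0_pi; rewrite subr_gt0 ji /= lt_neqAle abpi /=; lra.
    by move=> /(exprn_gt0 2); lra.
  - by rewrite -Bg -BE; apply: Bmax.
  rewrite -BE; have [gpi|gpi] := leP g (pi / 2).
    have -> : D - E = B (g + pi / 2) (g + pi / 2).
      rewrite BE subrr cos0 mulr1; have -> : g + pi / 2 + (g + pi / 2) = a1 + b1 + pi.
        by rewrite /g; field.
      by rewrite cosDpi sinDpi /E; ring.
    by apply: Bmax; lra.
  have -> : D - E = B (g - pi / 2) (g - pi / 2).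
    rewrite BE subrr cos0 mulr1; have -> : g - pi / 2 + (g - pi / 2) = a1 + b1 - pi.
      by rewrite /g; field.
    have -> : E = A * cos (a1 + b1 - pi + pi) + C * sin (a1 + b1 - pi + pi).
      by rewrite subrK.
    by rewrite cosDpi sinDpi; ring.
  by apply: Bmax; lra.
have := Bmin g g gK gK; rewrite Bg BE D0 mul0r add0r => /(_ erefl).
have : 0 < (a1 - b1) ^+ 2 by rewrite exprn_gt0// subr_gt0.
by rewrite /g; nra.
Qed.

(** The vectors x and y are the points of angles 0 and pi / 2. *)
Lemma banach_bound (c : R) p q : (0 < m)%N -> (p + q)%N = m ->
  (forall t, `|L (fun=> ellipse t)| <= c) ->
  `|formS L (nseq p x ++ nseq q y)| <= c.
Proof.
move=> m0 pq Lc; pose th (i : 'I_m) : R := if (i < p)%N then 0 else pi / 2.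
have -> : formS L (nseq p x ++ nseq q y) = angle_form th.
  congr (L _); apply/funext => i; rewrite nth_cat size_nseq /th /ellipse.
  case: ltnP => ip; first by rewrite nth_nseq ip cos0 sin0 scale1r scale0r addr0.
  have iq : (i - p < q)%N by have := ltn_ord i; lia.
  by rewrite nth_nseq iq cos_pihalf sin_pihalf scale0r scale1r add0r.
apply: banach_angle_bound => // i; rewrite /th; have := pi_gt0 R.
by case: ifP => _; lra.
Qed.

End Banach.

(** * Upper bounds for the derivatives *)

Section Upper.
Context (R : realType) (X : normedModType R) (m : nat).

(** The norm of a continuous homogeneous polynomial is finite, so that the
    products of extended reals in the definition of the constants are products
    of reals. *)
Lemma poly_norm_fin (P : X -> R) : (0 < m)%N -> homogeneous_polynomial m P ->
  exists2 N, 0 <= N & poly_norm P = N%:E.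
Proof.
move=> m0 [L [Lc Ls Lm PL]]; have [C C0 CL] := form_bounded Lm Lc m0.
have PC : (poly_norm P <= C%:E)%E.
  apply/ereal_supP => _ [x /unit_ballE x1 <-]; rewrite lee_fin PL.
  apply: le_trans (CL _) _; rewrite ler_piMr//.
  by apply: prodr_ile1 => i _; rewrite normr_ge0.
have P0 : (0 <= poly_norm P)%E.
  apply: (@le_trans _ _ `|P 0|%:E); first by rewrite lee_fin.
  by apply: ereal_sup_ubound; exists 0 => //; apply/unit_ballE; rewrite normr0.
have Pfin : poly_norm P \is a fin_num by rewrite ge0_fin_numE// (le_lt_trans PC) ?ltry.
by exists (fine (poly_norm P)); [exact: fine_ge0|rewrite fineK].
Qed.

Lemma le_poly_norm (P : X -> R) N x : poly_norm P = N%:E -> `|x| <= 1 -> `|P x| <= N.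
Proof.
move=> PN x1; rewrite -lee_fin -PN; apply: ereal_sup_ubound.
by exists x => //; apply/unit_ballE.
Qed.

(** The quantity n^(n/2), which is 1 for n = 0. *)
Definition sqrt_pow (n : nat) : R := Num.sqrt n%:R ^+ n.

Lemma sqrt_powE n : n%:R `^ (n%:R / 2) = sqrt_pow n.
Proof.
by rewrite mulrC powRrM powR12_sqrt ?ler0n// powR_mulrn// sqrtr_ge0.
Qed.

Lemma sqrt_pow_gt0 n : 0 < sqrt_pow n.
Proof.
by case: n => [|n]; rewrite /sqrt_pow ?expr0// exprn_gt0// sqrtr_gt0 ltr0n.
Qed.

Lemma sqrt_pow_sqr n : sqrt_pow n ^+ 2 = n%:R ^+ n.
Proof. by rewrite /sqrt_pow -exprM mulnC exprM sqr_sqrtr ?ler0n. Qed.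

Context (L : ('I_m -> X) -> R).
Hypothesis Lcont : continuous_form L.
Hypothesis Lmul : multilinear_form L.
Hypothesis Lsym : symmetric_form L.
Local Notation LS := (formS L).
Context (N : R).
Hypothesis LN : forall x, `|x| <= 1 -> `|L (fun=> x)| <= N.

(** Banach's theorem is applied to a x and b y with a^2 = (m - k)/m and
    b^2 = k/m.  By the Cauchy-Schwarz inequality, the ellipse that they span lies
    in the unit ball.  This choice of weights maximizes a^(m-k) b^k under
    a^2 + b^2 = 1. *)
Lemma mixed_bound k x y : (0 < m)%N -> (k <= m)%N -> `|x| <= 1 -> `|y| <= 1 ->
  `|LS (nseq (m - k) x ++ nseq k y)| <=
    sqrt_pow m / (sqrt_pow (m - k) * sqrt_pow k) * N.
Proof.
move=> m0 km x1 y1; set q := (m - k)%N.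
have qkm : (q + k)%N = m by rewrite subnK.
have sm0 : 0 < Num.sqrt (m%:R : R) by rewrite sqrtr_gt0 ltr0n.
have [a aE] : exists a : R, a = Num.sqrt q%:R / Num.sqrt m%:R by eexists.
have [b bE] : exists b : R, b = Num.sqrt k%:R / Num.sqrt m%:R by eexists.
have a0 : 0 <= a by rewrite aE divr_ge0 ?sqrtr_ge0.
have b0 : 0 <= b by rewrite bE divr_ge0 ?sqrtr_ge0.
have ab1 : a ^+ 2 + b ^+ 2 = 1.
  rewrite aE bE !exprMn !exprVn !sqr_sqrtr ?ler0n// -mulrDl -natrD qkm divff//.
  by rewrite pnatr_eq0 -lt0n.
have bound : `|LS (nseq q (a *: x) ++ nseq k (b *: y))| <= N.
  apply: banach_bound => // t; apply: LN.
  rewrite /ellipse; apply: le_trans (ler_normD _ _) _.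
  rewrite !normrZ (ger0_norm a0) (ger0_norm b0).
  apply: (@le_trans _ _ (`|cos t| * a + `|sin t| * b)).
    by apply: lerD; rewrite ler_wpM2l// ler_piMr.
  rewrite -(@ler_pXn2r _ 2)// ?nnegrE ?addr_ge0 ?mulr_ge0// expr1n.
  have := cos2Dsin2 t.
  rewrite -(real_normK (num_real (cos t))) -(real_normK (num_real (sin t))).
  move: `|cos t| `|sin t| => c s cs.
  (* The Cauchy-Schwarz inequality through Lagrange's identity. *)
  have -> : 1 = (c ^+ 2 + s ^+ 2) * (a ^+ 2 + b ^+ 2) by rewrite cs ab1 mulr1.
  by rewrite -subr_ge0; have := sqr_ge0 (c * b - s * a); lra.
move: bound; rewrite formS_nseqZ//; last by rewrite size_nseq.
rewrite (@formS_perm _ _ _ _ Lsym _ (nseq k y ++ nseq q (a *: x))); first last.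
- by rewrite perm_catC.
- by rewrite size_cat !size_nseq.
rewrite formS_nseqZ//; last by rewrite size_nseq addnC.
rewrite (@formS_perm _ _ _ _ Lsym _ (nseq q x ++ nseq k y)); first last.
- by rewrite perm_catC.
- by rewrite size_cat !size_nseq addnC.
rewrite mulrA normrM ger0_norm; last by rewrite mulr_ge0// exprn_ge0.
have -> : b ^+ k * a ^+ q = (sqrt_pow m / (sqrt_pow q * sqrt_pow k))^-1.
  have smE : sqrt_pow m = Num.sqrt m%:R ^+ q * Num.sqrt m%:R ^+ k.
    by rewrite -exprD qkm.
  rewrite aE bE invf_div smE /sqrt_pow !expr_div_n; field.
  by rewrite ?expf_neq0 ?gt_eqF.
by rewrite ler_pdivrMl// divr_gt0 ?mulr_gt0 ?sqrt_pow_gt0.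
Qed.

Lemma ffactE k : (m ^_ k)%:R = 'C(m, k)%:R * k`!%:R :> R.
Proof. by rewrite -natrM bin_ffact. Qed.

Lemma codom_cst k (y : X) : codom (fun _ : 'I_k => y) = nseq k y.
Proof.
rewrite -[in RHS](size_enum_ord k) /codom /image_mem.
by elim: (enum _) => //= _ s ->.
Qed.

Lemma deriv_poly_bound k x y : (0 < m)%N -> (k <= m)%N -> `|x| <= 1 -> `|y| <= 1 ->
  `|derivF L x (fun _ : 'I_k => y)| <=
  'C(m, k)%:R * (k`!%:R * sqrt_pow m / (sqrt_pow (m - k) * sqrt_pow k)) * N.
Proof.
move=> m0 km x1 y1; rewrite /derivF normrM ger0_norm// ffactE.
rewrite -!mulrA !ler_wpM2l// mulrA.
rewrite (@formS_perm _ _ _ _ Lsym _ (nseq (m - k) x ++ nseq k y)).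
- exact: mixed_bound.
- exact: size_args.
by rewrite perm_catC codom_cst perm_refl.
Qed.

(** The polarization inequality in the k free entries, the m - k entries x
    being fixed, multiplies the bound for equal entries by k^k / k!. *)
Lemma deriv_form_bound k x (y : 'I_k -> X) : (0 < m)%N -> (k <= m)%N ->
  `|x| <= 1 -> (forall i, `|y i| <= 1) ->
  `|derivF L x y| <=
  'C(m, k)%:R * (sqrt_pow m * sqrt_pow k / sqrt_pow (m - k)) * N.
Proof.
move=> m0 km x1 y1; rewrite /derivF normrM ger0_norm// ffactE.
rewrite -!mulrA ler_wpM2l//.
rewrite (@formS_perm _ _ _ _ Lsym _ (nseq (m - k) x ++ codom y)); first last.
- by rewrite perm_catC.
- exact: size_args.
have := @polarization_bound _ _ _ _ Lmul Lsym
  (sqrt_pow m / (sqrt_pow (m - k) * sqrt_pow k) * N) k (nseq (m - k) x) (codom y).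
rewrite size_nseq subnK// size_codom card_ord => /(_ erefl erefl) pol.
apply: le_trans (pol _ _) _.
- by move=> _ /codomP[i ->].
- by move=> z z1; apply: mixed_bound.
rewrite -sqrt_pow_sqr le_eqVlt; apply/orP; left; apply/eqP.
by field; rewrite !gt_eqF ?sqrt_pow_gt0.
Qed.

End Upper.

(** * The space of tuples with the sum norm *)

Section Coordinates.
Context (R : realType) (X : normedModType R) (n : nat).
Context (c : 'I_n -> X -> R).
Hypothesis cB : forall i x y, c i (x - y) = c i x - c i y.
Hypothesis c_le : forall i x, `|c i x| <= `|x|.

Lemma coord_continuous i : continuous (c i).
Proof.
move=> x; apply/cvgrPdist_lt => e e0; near=> y.
rewrite -cB; apply: le_lt_trans (c_le _ _) _.
by near: y; apply: cvgr_dist_lt.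
Unshelve. all: by end_near. Qed.

Hypothesis le_c : forall x, `|x| <= \sum_i `|c i x|.
Hypothesis c_surj : forall t : 'I_n -> R, exists x, forall i, c i x = t i.

(** The coordinates of a Cauchy filter converge; the filter converges to the
    vector of the limits because the norm is at most the sum of the absolute
    values of the coordinates. *)
Lemma coord_complete (F : set_system X) :
  ProperFilter F -> cauchy F -> cvg F.
Proof.
move=> PF /cauchy_ballP cF.
have cvi i : cvg (c i @ F).
  apply: R_complete; apply/cauchy_ballP => e e0.
  rewrite near_map2; apply: filterS (cF e e0) => -[x y] /=.
  by rewrite -!ball_normE/= -cB; apply: le_lt_trans.
have [l cl] := c_surj (fun i => lim (c i @ F)).
apply/cvg_ex; exists l; apply/cvgrPdist_lt => e e0; near=> x.
suff : `|l - x| < \sum_(i < n.+1) (e / n.+1%:R).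
  by rewrite sumr_const card_ord -[ltRHS]mulr_natr divfK.
have le1 i : `|c i (l - x)| <= e / n.+1%:R.
  rewrite cB cl.
  move: (i); near: x; apply: filter_forall => j.
  have : 0 < e / n.+1%:R by rewrite divr_gt0.
  by move: (cvi j) => /cvgrPdist_le; apply.
apply: le_lt_trans (le_c _) _.
rewrite big_ord_recr/= -[ltLHS]addr0 ler_ltD ?divr_gt0//.
by apply: ler_sum => i _; apply: le1.
Unshelve. all: by end_near. Qed.

End Coordinates.

(** Finite functions carry a module structure and no norm, so that the sum
    norm can be given to this copy without conflict. *)
Definition ell1 (R : realType) (n : nat) : Type := {ffun 'I_n -> R^o}.

Section Ell1.
Context (R : realType) (n : nat).

HB.instance Definition _ := GRing.Lmodule.on (ell1 R n).

Definition ell1_coord (i : 'I_n) (x : ell1 R n) : R := (x : {ffun _}) i.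

Definition ell1_norm (x : ell1 R n) : R := \sum_i `|ell1_coord i x|.

Lemma ell1_normD (x y : ell1 R n) :
  ell1_norm (x + y) <= ell1_norm x + ell1_norm y.
Proof.
by rewrite -big_split ler_sum// => i _; rewrite /ell1_coord ffunE ler_normD.
Qed.

Lemma ell1_normZ (a : R) (x : ell1 R n) :
  ell1_norm (a *: x) = `|a| * ell1_norm x.
Proof.
by rewrite mulr_sumr; apply: eq_bigr => i _; rewrite /ell1_coord ffunE normrM.
Qed.

Lemma ell1_norm_eq0 (x : ell1 R n) : ell1_norm x = 0 -> x = 0.
Proof.
move=> /eqP; rewrite psumr_eq0// => /allP x0; apply/ffunP => i; rewrite ffunE.
by apply/eqP; rewrite -normr_eq0; apply: (x0 i); rewrite mem_index_enum.
Qed.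

HB.instance Definition _ := @Lmodule_isNormed.Build R (ell1 R n)
  ell1_norm ell1_normD ell1_normZ ell1_norm_eq0.

Lemma ell1_normE (x : ell1 R n) : `|x| = \sum_i `|ell1_coord i x|.
Proof. by []. Qed.

Lemma ell1_coordB i (x y : ell1 R n) :
  ell1_coord i (x - y) = ell1_coord i x - ell1_coord i y.
Proof. by rewrite /ell1_coord !ffunE. Qed.

Lemma norm_ell1_coord i (x : ell1 R n) : `|ell1_coord i x| <= `|x|.
Proof.
by rewrite ell1_normE (bigD1 i)//= lerDl; apply: sumr_ge0.
Qed.

Lemma ell1_coord_continuous i : continuous (ell1_coord i).
Proof. exact: (coord_continuous ell1_coordB norm_ell1_coord). Qed.

Lemma ell1_complete (F : set_system (ell1 R n)) :
  ProperFilter F -> cauchy F -> cvg F.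
Proof.
apply: (coord_complete ell1_coordB norm_ell1_coord) => // t.
by exists [ffun i => t i] => i; rewrite /ell1_coord ffunE.
Qed.

HB.instance Definition _ := Uniform_isComplete.Build (ell1 R n) ell1_complete.

End Ell1.

(** * Lower bounds from the product of the coordinates *)

Section Permanent.
Context (R : realType) (m : nat).
Local Notation X := (ell1 R m).
Local Notation coord := (@ell1_coord R m).

(** The permanent of the matrix with entries coord i (v j).  Divided by m!, it
    is the symmetric m-linear form of the product of the coordinates. *)
Definition permanent (v : 'I_m -> X) : R :=
  \sum_(s : 'S_m) \prod_i coord i (v (s i)).

Definition perm_form (v : 'I_m -> X) : R := (m`!%:R)^-1 * permanent v.

Lemma perm_form_symmetric : symmetric_form perm_form.
Proof.
move=> t v; rewrite /perm_form; congr (_ * _).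
rewrite [RHS](reindex_inj (mulIg t)) /=; apply: eq_bigr => s _.
by apply: eq_bigr => i _; rewrite permM.
Qed.

Lemma perm_form_multilinear : multilinear_form perm_form.
Proof.
move=> j v a u w; rewrite /perm_form mulrCA -mulrDr; congr (_ * _).
rewrite mulr_sumr -big_split /=; apply: eq_bigr => s _.
have split_j u' : \prod_i coord i (@dfwith _ (fun=> X) v j u' (s i)) =
    coord ((s^-1)%g j) u' * \prod_(i | i != (s^-1)%g j) coord i (v (s i)).
  rewrite (bigD1 ((s^-1)%g j))//= updE permKV eqxx; congr (_ * _).
  apply: eq_bigr => i ij; rewrite updE; case: (s i =P j) ij => // <-.
  by rewrite permK eqxx.
rewrite !split_j mulrA -mulrDl; congr (_ * _).
by rewrite /ell1_coord !ffunE.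
Qed.

Lemma perm_form_continuous : continuous_form perm_form.
Proof.
have pc : continuous (permanent : {ptws 'I_m -> X} -> R).
  apply: continuous_big => [|s _]; first exact: add_continuous.
  apply: continuous_big => [|i _ v]; first exact: mul_continuous.
  exact: continuous_comp (@ptws_eval_continuous 'I_m X (s i) v)
    (@ell1_coord_continuous R m i _).
by move=> v; exact: cvgM (cvg_cst _) (pc v).
Qed.

Definition coord_prod (x : X) : R := perm_form (fun=> x).

Lemma coord_prodE x : coord_prod x = \prod_i coord i x.
Proof.
rewrite /coord_prod /perm_form /permanent sumr_const cardT -cardE card_Sn.
by rewrite -[X in _ * X]mulr_natl mulKf// pnatr_eq0 -lt0n fact_gt0.
Qed.

Lemma coord_prod_homogeneous : homogeneous_polynomial m coord_prod.
Proof.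
exists perm_form; split => //; first exact: perm_form_continuous.
  exact: perm_form_symmetric.
exact: perm_form_multilinear.
Qed.

(** The inequality between the arithmetic and the geometric mean. *)
Lemma coord_prod_norm : (0 < m)%N -> (poly_norm coord_prod <= ((m ^ m)%:R^-1)%:E)%E.
Proof.
move=> m0; apply/ereal_supP => _ [x /unit_ballE x1 <-].
rewrite lee_fin coord_prodE normr_prod.
have [/= + _] := @leif_AGM R 'I_m predT (fun i => `|coord i x|) (fun i _ => normr_ge0 _).
rewrite card_ord => /le_trans; apply.
rewrite -ell1_normE natrX -exprVn ler_pXn2r ?nnegrE ?divr_ge0 ?invr_ge0//.
by rewrite ler_piMl// invr_ge0.
Qed.

(** All terms of the permanent of a nonnegative matrix are nonnegative, so the
    terms indexed by G bound it below. *)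
Lemma perm_form_ge (v : 'I_m -> X) (G : {set 'S_m}) (c : R) :
  (forall i j, 0 <= coord i (v j)) ->
  (forall s, s \in G -> \prod_i coord i (v (s i)) = c) ->
  (m`!%:R)^-1 * (#|G|%:R * c) <= perm_form v.
Proof.
move=> v0 vG; rewrite ler_wpM2l ?invr_ge0// /permanent (bigID (mem G)) /=.
rewrite (eq_bigr (fun=> c)) // sumr_const [leLHS]mulr_natl lerDl.
by apply: sumr_ge0 => s _; apply: prodr_ge0.
Qed.

End Permanent.

Section Lower.
Context (R : realType) (m k : nat).
Hypothesis k_gt0 : (0 < k)%N.
Hypothesis km : (k <= m)%N.
Local Notation X := (ell1 R m).
Local Notation q := (m - k)%N.

Let m_gt0 : (0 < m)%N. Proof. exact: leq_trans km. Qed.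

Definition head_pt : X := [ffun i : 'I_m => if (i < k)%N then k%:R^-1 else 0].
Definition tail_pt : X := [ffun i : 'I_m => if (i < k)%N then 0 else q%:R^-1].
Definition unit_pt (j : 'I_m) : X := [ffun i => (i == j)%:R].

Definition head_set : {set 'I_m} := [set i : 'I_m | (i < k)%N]%SET.

Lemma card_head_set : #|head_set| = k.
Proof.
have inj : injective (widen_ord km) by move=> i j /(congr1 val) /= /val_inj.
rewrite -[RHS]card_ord -(fintype.card_image inj).
apply: eq_card => i; rewrite inE; apply/idP/fintype.imageP => [ik|[j _ ->]] //=.
by exists (Ordinal ik) => //; apply: val_inj.
Qed.

Lemma card_tail_set : #|~: head_set| = q.
Proof. by rewrite cardsCs finset.setCK card_head_set card_ord. Qed.

Lemma norm_head_pt : `|head_pt| <= 1.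
Proof.
rewrite ell1_normE (eq_bigr (fun i => if i \in head_set then k%:R^-1 else 0)).
  rewrite -big_mkcond sumr_const card_head_set -[leLHS]mulr_natl divff//.
  by rewrite pnatr_eq0 -lt0n.
move=> i _; rewrite /ell1_coord ffunE inE; case: ifP; rewrite ?normr0// => _.
by rewrite ger0_norm ?invr_ge0.
Qed.

Lemma norm_tail_pt : `|tail_pt| <= 1.
Proof.
rewrite ell1_normE (eq_bigr (fun i => if i \in ~: head_set then q%:R^-1 else 0)).
  rewrite -big_mkcond sumr_const card_tail_set -[leLHS]mulr_natl.
  by have [->|q0] := eqVneq q 0%N; rewrite ?mul0r// divff// pnatr_eq0.
move=> i _; rewrite /ell1_coord ffunE !inE; case: ifP; rewrite ?normr0// => _.
by rewrite ger0_norm ?invr_ge0.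
Qed.

Lemma norm_unit_pt j : `|unit_pt j| <= 1.
Proof.
rewrite ell1_normE (bigD1 j)//= big1 => [|i ij].
  by rewrite /ell1_coord ffunE eqxx normr1 addr0.
by rewrite /ell1_coord ffunE (negbTE ij) normr0.
Qed.

Lemma perm_on_tailP (s : 'S_m) : s \in Sym (~: head_set) ->
  (forall i, i \in head_set -> s i = i) /\ (forall i, (s i < k)%N = (i < k)%N).
Proof.
rewrite inE => sS; split=> [i iA|i]; first by apply: (out_perm sS); rewrite inE negbK.
have := perm_closed i sS; rewrite !inE => E.
by apply/idP/idP; apply: contraLR; rewrite E.
Qed.

Lemma perm_on_headP (s : 'S_m) : s \in Sym head_set ->
  forall i, (s i < k)%N = (i < k)%N.
Proof. by rewrite inE => sS i; have := perm_closed i sS; rewrite !inE. Qed.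

Lemma prod_head_tail (a b : R) :
  \prod_(i < m) (if (i < k)%N then a else b) = a ^+ k * b ^+ q.
Proof.
have -> : a ^+ k = \prod_(i in head_set) a by rewrite prodr_const card_head_set.
have -> : b ^+ q = \prod_(i in ~: head_set) b by rewrite prodr_const card_tail_set.
rewrite (bigID (mem head_set)) /=; congr (_ * _).
  by apply: eq_big => [i|i]; rewrite !inE// => ->.
by apply: eq_big => [i|i]; rewrite !inE// => /negbTE ->.
Qed.

Lemma perm_form_formS (y : 'I_k -> X) x :
  formS (@perm_form R m) (codom y ++ nseq q x) =
  perm_form (fun i : 'I_m => if insub (i : nat) is Some j then y j else x).
Proof.
congr (perm_form _); apply/funext => i; rewrite nth_cat size_codom card_ord.
case: insubP => [j ik ji|].
  rewrite ik (nth_map j) ?size_enum_ord//; congr (y _).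
  by apply: val_inj; rewrite /= nth_enum_ord.
by rewrite -leqNgt => ki; rewrite ltnNge ki nth_nseq ltn_sub2r// (leq_ltn_trans ki).
Qed.

Let ffact_q : (m ^_ k)%:R * ((m`!%:R)^-1 * q`!%:R) = 1 :> R.
Proof.
rewrite mulrCA -natrM ffact_fact// mulVf// pnatr_eq0 -lt0n fact_gt0//.
Qed.

(** The permutations that preserve the first k indices are the products of one
    permutation of these and one of the others.  There are k! (m - k)! of them,
    and each contributes k^(-k) (m - k)^(-(m-k)). *)
Lemma deriv_poly_ge :
  k`!%:R / (q ^ q * k ^ k)%:R <=
  derivF (@perm_form R m) tail_pt (fun _ : 'I_k => head_pt).
Proof.
rewrite /derivF perm_form_formS.
pose G : {set 'S_m} := (Sym head_set * Sym (~: head_set))%g.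
have cardG : #|G| = (k`! * q`!)%N.
  have -> : (k`! * q`!)%N = (#|Sym head_set| * #|Sym (~: head_set)|)%N.
    by rewrite !card_Sym card_head_set card_tail_set.
  apply: TI_cardMg.
  apply/trivgP/fintype.subsetP => s; rewrite inE => /andP[/[!inE] s1 s2].
  apply/eqP/permP => i; rewrite perm1.
  have [iA|iA] := boolP (i \in head_set).
    by apply: (out_perm s2); rewrite inE negbK.
  exact: (out_perm s1).
set v := fun i : 'I_m => _.
have vE i j : ell1_coord i (v j) =
    if (j < k)%N then (if (i < k)%N then k%:R^-1 else 0)
    else (if (i < k)%N then 0 else q%:R^-1).
  by rewrite /v; case: insubP => [l lk _|/negbTE ->]; rewrite ?lk /ell1_coord ffunE.
have -> : k`!%:R / (q ^ q * k ^ k)%:R =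
    (m ^_ k)%:R * ((m`!%:R)^-1 * (#|G|%:R * (k%:R^-1 ^+ k * q%:R^-1 ^+ q))) :> R.
  rewrite cardG natrM !natrX invfM -!exprVn (natrM R k`!).
  have -> (a b c d e f : R) : a * (b * (c * d * (e * f))) = a * (b * d) * (c * (f * e)).
    by ring.
  by rewrite ffact_q mul1r.
apply: ler_wpM2l => //; apply: perm_form_ge => [i j|s].
  by rewrite vE; do 2 case: ifP => _; rewrite ?invr_ge0.
case/mulsgP => s1 s2 /perm_on_headP S1 /perm_on_tailP[_ S2] ->.
rewrite -prod_head_tail; apply: eq_bigr => i _.
by rewrite vE permM S2 S1; case: (i < k)%N.
Qed.

(** A permutation that fixes the first k indices contributes
    (m - k)^(-(m-k)), and there are (m - k)! of them. *)
Lemma deriv_form_ge :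
  (q ^ q)%:R^-1 <=
  derivF (@perm_form R m) tail_pt (fun i : 'I_k => unit_pt (widen_ord km i)).
Proof.
rewrite /derivF perm_form_formS.
set v := fun i : 'I_m => _.
have vE i j : ell1_coord i (v j) =
    if (j < k)%N then (i == j)%:R else (if (i < k)%N then 0 else q%:R^-1).
  rewrite /v; case: insubP => [l lk lj|/negbTE ->]; rewrite ?lk /ell1_coord ffunE//.
  by congr (_ == _)%:R; apply: val_inj.
have -> : (q ^ q)%:R^-1 = (m ^_ k)%:R *
    ((m`!%:R)^-1 * (#|Sym (~: head_set)|%:R * (1 ^+ k * q%:R^-1 ^+ q))) :> R.
  rewrite card_Sym card_tail_set expr1n mul1r (mulrA (m`!%:R)^-1) mulrA ffact_q.
  by rewrite mul1r natrX exprVn.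
apply: ler_wpM2l => //; apply: perm_form_ge => [i j|s].
  by rewrite vE; case: ifP => _; [exact: ler0n|case: ifP => _ //; rewrite invr_ge0].
move=> /perm_on_tailP[S1 S2].
rewrite -prod_head_tail; apply: eq_bigr => i _.
by rewrite vE S2; case ik: (i < k)%N => //; rewrite S1 ?inE// eqxx.
Qed.

(** An admissible constant M is positive because v is, so that the bound m^(-m)
    for the norm of the product of the coordinates can be used in v <= M ||P||. *)
Lemma markov_const_ge (M v : R) (n : \bar R) : 0 < v -> (v%:E <= n)%E ->
  (n <= M%:E * poly_norm (@coord_prod R m))%E -> (m ^ m)%:R * v <= M.
Proof.
move=> v0 vn nM; have mm0 : 0 < (m ^ m)%:R :> R by rewrite ltr0n expn_gt0 m_gt0.
have [N N0 PN] := poly_norm_fin m_gt0 (@coord_prod_homogeneous R m).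
have := coord_prod_norm R m_gt0; rewrite PN lee_fin => Nm.
have : v <= M * N by rewrite -lee_fin EFinM -PN (le_trans vn).
move=> vMN; have M0 : 0 < M.
  rewrite ltNge; apply/negP => M0; have := lt_le_trans v0 vMN.
  by rewrite ltNge mulr_le0_ge0.
rewrite mulrC -ler_pdivlMr//; apply: le_trans vMN _.
by rewrite ler_wpM2l// ltW.
Qed.

Lemma poly_markov_ge : lbound (poly_markov_constants R m k)
  ((m ^ m * k`!)%N%:R / (q ^ q * k ^ k)%N%:R).
Proof.
move=> M /(_ (ell1 R m) (@coord_prod R m) (@coord_prod_homogeneous R m)).
have v0 : 0 < k`!%:R / (q ^ q * k ^ k)%:R :> R.
  rewrite divr_gt0// ltr0n ?fact_gt0// muln_gt0 !expn_gt0 k_gt0 andbT.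
  by case: q.
rewrite natrM -mulrA => h; apply: markov_const_ge v0 _ h.
apply: (@le_trans _ _ `|frechetD_poly k (@coord_prod R m) tail_pt head_pt|%:E).
  rewrite lee_fin /frechetD_poly frechetD_formS//.
  - exact: le_trans deriv_poly_ge (ler_norm _).
  - exact: perm_form_continuous.
  - exact: perm_form_multilinear.
  - exact: perm_form_symmetric.
apply: ereal_sup_ubound; exists tail_pt, head_pt; split=> //; apply/unit_ballE.
  exact: norm_tail_pt.
exact: norm_head_pt.
Qed.

Lemma form_markov_ge : lbound (form_markov_constants R m k)
  ((m ^ m)%N%:R / (q ^ q)%N%:R).
Proof.
move=> M /(_ (ell1 R m) (@coord_prod R m) (@coord_prod_homogeneous R m)).
have v0 : 0 < (q ^ q)%:R^-1 :> R.
  by rewrite invr_gt0 ltr0n expn_gt0; case: q.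
move=> h; apply: markov_const_ge v0 _ h.
pose y i := unit_pt (widen_ord km i).
apply: (@le_trans _ _ `|frechetD (@coord_prod R m) tail_pt y|%:E).
  rewrite lee_fin frechetD_formS//.
  - exact: le_trans deriv_form_ge (ler_norm _).
  - exact: perm_form_continuous.
  - exact: perm_form_multilinear.
  - exact: perm_form_symmetric.
apply: ereal_sup_ubound; exists tail_pt, y; split=> // [|i]; apply/unit_ballE.
  exact: norm_tail_pt.
exact: norm_unit_pt.
Qed.

End Lower.

(** * The smallest constants *)

Section Smallest.
Context (R : realType).

(** The admissible constants form a closed set, provided that the norm N of
    the polynomial is finite. *)
Lemma le_inf_mul (S : set R) (n : \bar R) (N : R) : S !=set0 -> has_lbound S ->
  0 <= N -> (forall M, S M -> (n <= (M * N)%:E)%E) -> (n <= (inf S * N)%:E)%E.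
Proof.
move=> [hi Shi] lbS N0 nS; have [N_eq0|N_gt0] : N = 0 \/ 0 < N.
  by move: N0; rewrite le_eqVlt => /predU1P[<-|]; [left|right].
  by have := nS _ Shi; rewrite N_eq0 !mulr0.
apply/lee_addgt0Pr => e e0.
have [M SM Minf] : exists2 M, S M & M < inf S + e / N.
  by apply: inf_adherent; [rewrite divr_gt0|split=> //; exists hi].
apply: le_trans (nS _ SM) _; rewrite -EFinD lee_fin.
by rewrite -ler_pdivlMr// mulrDl mulfK ?gt_eqF// ltW.
Qed.

Lemma smallest_exists m
    (nrm : forall X : completeNormedModType R, (X -> R) -> \bar R) (lo hi : R) :
  let S := [set M : R | forall (X : completeNormedModType R) (P : X -> R),
    homogeneous_polynomial m P -> (nrm X P <= M%:E * poly_norm P)%E] in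
  (forall (X : completeNormedModType R) (P : X -> R),
    homogeneous_polynomial m P -> exists2 N, 0 <= N & poly_norm P = N%:E) ->
  S hi -> lbound S lo -> exists2 M, is_smallest S M & lo <= M <= hi.
Proof.
move=> S fin Shi Slo; exists (inf S); last first.
  by rewrite lb_le_inf//=; [apply: inf_lbound => //; exists lo|exists hi].
split=> [X P hP|M SM]; last by apply: inf_lbound => //; exists lo.
have [N N0 PN] := fin X P hP; rewrite PN -EFinM.
apply: le_inf_mul => //; [by exists hi|by exists lo|].
by move=> M /(_ X P hP); rewrite PN -EFinM.
Qed.

End Smallest.

Section UpperConstants.
Context (R : realType) (m k : nat).
Hypothesis m_gt0 : (0 < m)%N.
Hypothesis km : (k <= m)%N.

Lemma poly_markov_mem : poly_markov_constants R m k
  ('C(m, k)%:R * (k`!%:R * sqrt_pow R m / (sqrt_pow R (m - k) * sqrt_pow R k))).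
Proof.
move=> X P hP; have [N N0 PN] := poly_norm_fin m_gt0 hP.
have [L [Lc Ls Lm PL]] := hP; have {}PL : P = (fun x => L (fun=> x)) by apply/funext.
rewrite PN -EFinM; apply/ereal_supP => _ [x [y [/unit_ballE x1 /unit_ballE y1 ->]]].
rewrite lee_fin /frechetD_poly PL frechetD_formS//.
apply: deriv_poly_bound => // z z1.
by have := le_poly_norm PN z1; rewrite PL.
Qed.

Lemma form_markov_mem : form_markov_constants R m k
  ('C(m, k)%:R * (sqrt_pow R m * sqrt_pow R k / sqrt_pow R (m - k))).
Proof.
move=> X P hP; have [N N0 PN] := poly_norm_fin m_gt0 hP.
have [L [Lc Ls Lm PL]] := hP; have {}PL : P = (fun x => L (fun=> x)) by apply/funext.
rewrite PN -EFinM; apply/ereal_supP => _ [x [y [/unit_ballE x1 y1 ->]]].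
rewrite lee_fin PL frechetD_formS//.
apply: deriv_form_bound => // [z z1|i]; last exact/unit_ballE.
by have := le_poly_norm PN z1; rewrite PL.
Qed.

End UpperConstants.

Theorem mainTheorem6 (R : realType) (m k : nat)
    (k_ge1 : (1 <= k)%N) (k_le_m : (k <= m)%N) :
  exists M K : R,
    [/\ is_smallest (poly_markov_constants R m k) M,
        is_smallest (form_markov_constants R m k) K,
        (m ^ m * k`!)%N%:R / ((m - k) ^ (m - k) * k ^ k)%N%:R <= M
          <= ('C(m, k))%:R *
             (k`!%:R * m%:R `^ (m%:R / 2) /
              ((m - k)%N%:R `^ ((m - k)%N%:R / 2) * k%:R `^ (k%:R / 2)))
      & (m ^ m)%N%:R / ((m - k) ^ (m - k))%N%:R <= K
          <= ('C(m, k))%:R *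
             (m%:R `^ (m%:R / 2) * k%:R `^ (k%:R / 2) /
              ((m - k)%N%:R `^ ((m - k)%N%:R / 2)))].
Proof.
have m_gt0 : (0 < m)%N by exact: leq_trans k_le_m.
have fin (X : completeNormedModType R) P := @poly_norm_fin R X m P m_gt0.
have [M Mmin Mle] := smallest_exists fin (@poly_markov_mem R m k m_gt0 k_le_m)
  (@poly_markov_ge R m k k_ge1 k_le_m).
have [K Kmin Kle] := smallest_exists fin (@form_markov_mem R m k m_gt0 k_le_m)
  (@form_markov_ge R m k k_ge1 k_le_m).
by exists M, K; rewrite !sqrt_powE.
Qed.
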